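(* Let $\varphi:\mathbb{K}(\mathbb{T}^{\mathcal D}_{\mathbf{C}_{CK}})\to\mathbb{K}(\mathcal D)$ be a $\mathbb{K}$-linear map. There exists a unique Hopf algebra morphism $\Phi:\mathbf{C}^{\mathcal D}_{CK}\to\mathbf{Sh}^{\mathcal D}$ such that $\pi\circ\Phi\circ i=\varphi$.
   Context: $\mathbb{K}$ is a field of characteristic zero, $\mathcal D$ a nonempty set. $\mathbf{C}^{\mathcal D}_{CK}$ is the algebra spanned by rooted forests (up to isomorphism) with edges decorated by $\mathcal D$, product the disjoint union, modulo the ideal generated by $\bullet-1$ (the one-vertex tree identified with the unit, so isolated vertices are deleted); it is a Hopf algebra graded by the number of edges with coproduct $\Delta(F)=\sum_{\boldsymbol e\subseteq E(F)}Part_{\boldsymbol e}(F)\otimes Cont_{\boldsymbol e}(F)$, where $Part_{\boldsymbol e}(F)$ keeps all vertices and the edges of $\boldsymbol e$ and $Cont_{\boldsymbol e}(F)$ is obtained by contracting the edges of $\boldsymbol e$ (decorations of remaining edges kept), and counit $\varepsilon(F)=\delta_{F,\bullet}$. $\mathbb{T}^{\mathcal D}_{\mathbf{C}_{CK}}$ is the set of such trees with at least one edge and $i$ the inclusion of their span. $\mathbf{Sh}^{\mathcal D}$ is the shuffle Hopf algebra on words over $\mathcal D$ (shuffle product, deconcatenation coproduct) and $\pi$ the projection onto words of length one, identified with $\mathbb{K}(\mathcal D)$. *)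

(* Defs.v *)
From HB Require Import structures.
From mathcomp Require Import all_boot all_order all_algebra.
From mathcomp Require Import finmap generic_quotient boolp.
From mathcomp.multinomials Require Import monalg.

Set Implicit Arguments.
Unset Strict Implicit.
Unset Printing Implicit Defensive.

Import GRing.Theory.
Local Open Scope ring_scope.
Local Open Scope quotient_scope.

(* Plane representatives of rooted trees with edges decorated by D.
   [Dot] is the one-vertex tree; [Graft d s t] is t with one more child of its
   root, namely the root of s, the new edge being decorated by d.  Thus the
   occurrences of [Graft] are exactly the edges. *)
Inductive ptree (D : Type) : Type :=
| Dot : ptree D
| Graft : D -> ptree D -> ptree D -> ptree D.
Arguments Dot {D}.

Section PtreeChoice.
Variable D : choiceType.

Fixpoint gentree_of_ptree (t : ptree D) : GenTree.tree D :=
  match t with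
  | Dot => GenTree.Node 0 [::]
  | Graft d s t =>
      GenTree.Node 1 [:: GenTree.Leaf d; gentree_of_ptree s; gentree_of_ptree t]
  end.

Fixpoint ptree_of_gentree (g : GenTree.tree D) : option (ptree D) :=
  match g with
  | GenTree.Node 0 [::] => Some Dot
  | GenTree.Node 1 [:: GenTree.Leaf d; g1; g2] =>
      if ptree_of_gentree g1 is Some s then
        if ptree_of_gentree g2 is Some t then Some (Graft d s t) else None
      else None
  | _ => None
  end.

Lemma gentree_of_ptreeK : pcancel gentree_of_ptree ptree_of_gentree.
Proof. by elim=> [|d s /= -> t ->]. Qed.

HB.instance Definition _ := Choice.copy (ptree D) (pcan_type gentree_of_ptreeK).

End PtreeChoice.

(* Two plane trees represent isomorphic rooted trees iff one can be turned into
   the other by exchanging siblings (anywhere in the tree). *)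
Inductive ptree_iso (D : Type) : ptree D -> ptree D -> Prop :=
| iso_refl t : ptree_iso t t
| iso_sym t u : ptree_iso t u -> ptree_iso u t
| iso_trans t u v : ptree_iso t u -> ptree_iso u v -> ptree_iso t v
| iso_graft d s s' t t' : ptree_iso s s' -> ptree_iso t t' ->
    ptree_iso (Graft d s t) (Graft d s' t')
| iso_swap d1 s1 d2 s2 t :
    ptree_iso (Graft d1 s1 (Graft d2 s2 t)) (Graft d2 s2 (Graft d1 s1 t)).

Section Trees.
Variable D : choiceType.

Definition ptree_isob : rel (ptree D) := fun t u => `[< ptree_iso t u >].

Lemma ptree_isob_refl : reflexive ptree_isob.
Proof. by move=> t; apply/asboolP; exact: iso_refl. Qed.

Lemma ptree_isob_sym : symmetric ptree_isob.
Proof. by move=> t u; apply/asboolP/asboolP; exact: iso_sym. Qed.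

Lemma ptree_isob_trans : transitive ptree_isob.
Proof.
move=> u t v /asboolP tu /asboolP uv; apply/asboolP; exact: iso_trans tu uv.
Qed.

Canonical ptree_iso_equiv :=
  EquivRel ptree_isob ptree_isob_refl ptree_isob_sym ptree_isob_trans.

(* Isomorphism classes of rooted trees with edges decorated by D. *)
Definition tree := {eq_quot ptree_isob}%qT.
HB.instance Definition _ := Choice.on tree.
HB.instance Definition _ := EqQuotient.on tree.

(* The set E(t) of edges of a plane tree. *)
Fixpoint edge (t : ptree D) : finType :=
  match t with
  | Dot => void
  | Graft _ s t => option (edge s + edge t)%type
  end.

(* The set of isomorphism classes of trees with at least one edge. *)
Definition etree := {t : tree | 0 < #|edge (repr t)|}%N.
HB.instance Definition _ := SubChoice.on etree.

(* For e a set of edges of [Graft d s t], its traces on s and on t; the edge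
   joining the two roots is [None]. *)
Definition edgesl (A B : finType) (e : {set option (A + B)}) : {set A} :=
  [set x | Some (inl x) \in e].
Definition edgesr (A B : finType) (e : {set option (A + B)}) : {set B} :=
  [set x | Some (inr x) \in e].

(* The tree obtained by identifying the roots of s and t. *)
Fixpoint merge (s t : ptree D) : ptree D :=
  match s with
  | Dot => t
  | Graft d s1 s2 => Graft d s1 (merge s2 t)
  end.

(* Contraction of the edges of e. *)
Fixpoint cont (t : ptree D) : {set edge t} -> ptree D :=
  match t return {set edge t} -> ptree D with
  | Dot => fun _ => Dot
  | Graft d s t => fun e =>
      let s' := cont (edgesl e) in
      let t' := cont (edgesr e) in
      if None \in e then merge s' t' else Graft d s' t'
  end.

(* The forest with all the vertices of t and the edges in e, as the pair of the
   component containing the root of t and the list of the other components. *)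
Fixpoint part (t : ptree D) : {set edge t} -> ptree D * seq (ptree D) :=
  match t return {set edge t} -> ptree D * seq (ptree D) with
  | Dot => fun _ => (Dot, [::])
  | Graft d s t => fun e =>
      let s' := part (edgesl e) in
      let t' := part (edgesr e) in
      if None \in e then (Graft d s'.1 t'.1, s'.2 ++ t'.2)
      else (t'.1, s'.1 :: s'.2 ++ t'.2)
  end.

Fixpoint fedge (F : seq (ptree D)) : finType :=
  if F is t :: F' then (edge t + fedge F')%type else void.

Fixpoint fcont (F : seq (ptree D)) : {set fedge F} -> seq (ptree D) :=
  match F return {set fedge F} -> seq (ptree D) with
  | [::] => fun _ => [::]
  | t :: F' => fun e => cont (inl @^-1: e) :: fcont (inr @^-1: e)
  end.

Fixpoint fpart (F : seq (ptree D)) : {set fedge F} -> seq (ptree D) :=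
  match F return {set fedge F} -> seq (ptree D) with
  | [::] => fun _ => [::]
  | t :: F' => fun e =>
      let p := part (inl @^-1: e) in p.1 :: p.2 ++ fpart (inr @^-1: e)
  end.

End Trees.

(* Isomorphism classes of rooted forests modulo the identification of the
   one-vertex tree with 1: each class has a unique member without isolated
   vertices, i.e. it is a finite multiset of trees with at least one edge.  The
   product of [{cmonom _}] is the disjoint union. *)
Notation forest D := {cmonom (etree D)}.

Section Forests.
Variable D : choiceType.

Definition forest_of_tree (t : etree D) : forest D := ucm t.

(* The class of a forest: its isolated vertices are deleted. *)
Definition forest_class (F : seq (ptree D)) : forest D :=
  \big[mmul/mone]_(t <- F) oapp forest_of_tree mone (insub (\pi_(tree D) t)).

Definition forest_repr (F : forest D) : seq (ptree D) :=
  flatten [seq nseq (F t) (repr (val t)) | t <- finsupp F].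

Fixpoint shuffle (u : seq D) : seq D -> seq (seq D) :=
  match u with
  | [::] => fun v => [:: v]
  | a :: u' => fix shuffle_u (v : seq D) : seq (seq D) :=
      match v with
      | [::] => [:: u]
      | b :: v' => map (cons a) (shuffle u' v) ++ map (cons b) (shuffle_u v')
      end
  end.

End Forests.

(* [{malg K[B]}] is the K-vector space with basis B, [<< b >>] being the basis
   vector attached to b; the tensor product of the spaces with bases A and B is
   the space with basis A * B. *)
Section FreeModules.
Variable K : fieldType.

Definition linext (A : choiceType) (V : lmodType K) (f : A -> V)
    (x : {malg K[A]}) : V :=
  \sum_(a <- msupp x) x@_a *: f a.

Definition tens (A B : choiceType) (x : {malg K[A]}) (y : {malg K[B]}) :
    {malg K[(A * B)%type]} :=
  linext (fun a => linext (fun b => << (a, b) >>) y) x.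

Definition tensmap (A A' B B' : choiceType)
    (f : {malg K[A]} -> {malg K[A']}) (g : {malg K[B]} -> {malg K[B']}) :
    {malg K[(A * B)%type]} -> {malg K[(A' * B')%type]} :=
  linext (fun ab => tens (f << ab.1 >>) (g << ab.2 >>)).

End FreeModules.

(* [CK] is the monoid algebra of [forest D]; [Sh] is only a module, with the
   product [Sh_mul]. *)
Notation CK K D := {malg K[forest D]}.
Notation Sh K D := {malg K[seq D]}.

Section HopfAlgebras.
Variables (K : fieldType) (D : choiceType).

(* The term attached to F does not depend on the plane representative. *)
Definition CK_coprod : CK K D -> {malg K[(forest D * forest D)%type]} :=
  linext (fun F => \sum_(e : {set fedge (forest_repr F)})
    << (forest_class (fpart e), forest_class (fcont e)) >>).

Definition CK_counit (x : CK K D) : K := x@_mone.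

Definition CK_incl : {malg K[etree D]} -> CK K D :=
  linext (fun t => << forest_of_tree t >>).

Definition Sh_one : Sh K D := << [::] >>.

Definition Sh_mul (x y : Sh K D) : Sh K D :=
  linext (fun u => linext (fun v => \sum_(w <- shuffle u v) << w >>) y) x.

Definition Sh_coprod : Sh K D -> {malg K[(seq D * seq D)%type]} :=
  linext (fun w => \sum_(i < (size w).+1) << (take i w, drop i w) >>).

Definition Sh_counit (x : Sh K D) : K := x@_[::].

Definition Sh_proj : Sh K D -> {malg K[D]} :=
  linext (fun w => if w is [:: d] then << d >> else 0).

(* Morphisms of Hopf algebras are morphisms of bialgebras: these automatically
   commute with the antipodes. *)
Definition hopf_morphism (f : CK K D -> Sh K D) : Prop :=
  [/\ linear f,
      f 1 = Sh_one /\ (forall x y, f (x * y) = Sh_mul (f x) (f y)),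
      forall x, Sh_coprod (f x) = tensmap f f (CK_coprod x)
    & forall x, Sh_counit (f x) = CK_counit x].

End HopfAlgebras.

(* Main.v *)
(* [Sh] is cofree among the connected coalgebras: for a coalgebra morphism
   [Phi : CK -> Sh], put [f = Sh_proj \o Phi]; the coefficient of [d1 ... dn] in
   [Phi x] is the value at [x] of the convolution product [f_d1 * ... * f_dn] of
   the coordinates of [f].  So [Phi] is determined by [f], and conversely every
   [f] that vanishes at 1 defines a coalgebra morphism; the coefficients at [x]
   are finitely many because contracting an edge lowers the degree.  As the
   coordinate functions of [Sh_proj] kill products in the augmentation ideal,
   [Phi] is multiplicative exactly when [f] kills them too, that is when [f] is
   given by its values on trees, and these are prescribed by [phi]. *)

Require Import Defs.
From HB Require Import structures.
From mathcomp Require Import all_boot all_order all_algebra.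
From mathcomp Require Import finmap generic_quotient boolp.
From mathcomp Require Import zify.
From mathcomp.multinomials Require Import monalg.

Set Implicit Arguments.
Unset Strict Implicit.
Unset Printing Implicit Defensive.

Import Defs GRing.Theory.
Local Open Scope ring_scope.
Local Open Scope quotient_scope.

(** * Sums over edge subsets, computed by recursion on plane trees and forests *)

Section CutSums.
Variables (D : choiceType) (V : nmodType).
Implicit Types (s t : ptree D) (F : seq (ptree D)).
Implicit Types (G : ptree D -> seq (ptree D) -> ptree D -> V).
Implicit Types (H : seq (ptree D) -> seq (ptree D) -> V).

(* The component of the root is kept apart from the other components: grafting
   and merging only act on it, which makes this sum computable by recursion. *)
Definition tsum t G : V :=
  \sum_(e : {set edge t}) G (part e).1 (part e).2 (cont e).

Definition fsum F H : V := \sum_(e : {set fedge F}) H (fpart e) (fcont e).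

Lemma eq_tsum t G G' : (forall p o c, G p o c = G' p o c) -> tsum t G = tsum t G'.
Proof. by move=> eqG; apply: eq_bigr => e _. Qed.

Lemma eq_fsum F H H' : (forall a b, H a b = H' a b) -> fsum F H = fsum F H'.
Proof. by move=> eqH; apply: eq_bigr => e _. Qed.

Lemma tsumD t G G' :
  tsum t (fun p o c => G p o c + G' p o c) = tsum t G + tsum t G'.
Proof. exact: big_split. Qed.

Lemma fsumD F H H' :
  fsum F (fun a b => H a b + H' a b) = fsum F H + fsum F H'.
Proof. exact: big_split. Qed.

Lemma tsum_exchange s t
    (G : ptree D -> seq (ptree D) -> ptree D ->
         ptree D -> seq (ptree D) -> ptree D -> V) :
  tsum s (fun p o c => tsum t (G p o c)) =
  tsum t (fun p' o' c' => tsum s (fun p o c => G p o c p' o' c')).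
Proof. exact: exchange_big. Qed.

Lemma tfsum_exchange t F
    (G : ptree D -> seq (ptree D) -> ptree D ->
         seq (ptree D) -> seq (ptree D) -> V) :
  tsum t (fun p o c => fsum F (G p o c)) =
  fsum F (fun a b => tsum t (fun p o c => G p o c a b)).
Proof. exact: exchange_big. Qed.

Lemma fsum_exchange F F'
    (H : seq (ptree D) -> seq (ptree D) ->
         seq (ptree D) -> seq (ptree D) -> V) :
  fsum F (fun a b => fsum F' (H a b)) =
  fsum F' (fun a' b' => fsum F (fun a b => H a b a' b')).
Proof. exact: exchange_big. Qed.

Lemma set_void (A : {set void}) : A = set0.
Proof. by apply/setP; case. Qed.

Lemma tsum_Dot G : tsum Dot G = G Dot [::] Dot.
Proof.
rewrite /tsum (bigD1 (set0 : {set edge Dot})) //= big1 ?addr0 // => e.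
by rewrite [e]set_void eqxx.
Qed.

(** An edge set of the grafted tree amounts to an edge set of [s], one of [t] and a bit telling
    whether the root edge is selected; the two summands are the two values of this bit. *)
Lemma tsum_Graft d s t G :
  tsum (Graft d s t) G =
  tsum s (fun p o c => tsum t (fun p' o' c' =>
    G (Graft d p p') (o ++ o') (merge c c') +
    G p' (p :: o ++ o') (Graft d c c'))).
Proof.
pose E := {set option (edge s + edge t)}.
(* [mk] and [un] are mutually inverse; the sum is reindexed along [mk]. *)
pose mk (x : ({set edge s} * {set edge t}) * bool) : E :=
  [set y | match y with None => x.2 | Some (inl y) => y \in x.1.1
           | Some (inr y) => y \in x.1.2 end].
pose un (e : E) := (edgesl e, edgesr e, None \in e).
have unK x : un (mk x) = x.
  case: x => [[e1 e2] b]; rewrite /un /mk inE /=; congr (_, _, _).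
  - by apply/setP => y; rewrite !inE.
  - by apply/setP => y; rewrite !inE.
have mkK e : mk (un e) = e.
  by apply/setP => -[[y|y]|]; rewrite /mk /un !inE.
have mkE e1 e2 b : [/\ edgesl (mk (e1, e2, b)) = e1,
    edgesr (mk (e1, e2, b)) = e2 & (None \in mk (e1, e2, b)) = b].
  by have [-> -> ->] := unK (e1, e2, b).
have sumE (f : E -> V) : \sum_e f e =
    \sum_e1 \sum_e2 (f (mk (e1, e2, true)) + f (mk (e1, e2, false))).
  rewrite (reindex mk) /=; last by exists un => x _; [exact: unK|exact: mkK].
  rewrite (eq_bigr (fun x => f (mk (x.1, x.2)))); last by case.
  rewrite -(pair_bigA _ (fun x b => f (mk (x, b)))) /= [RHS]pair_bigA.
  by apply: eq_bigr => -[e1 e2] _; rewrite big_bool.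
rewrite [LHS]sumE; apply: eq_bigr => e1 _; apply: eq_bigr => e2 _ /=.
by have [-> -> ->] := mkE e1 e2 true; have [-> -> ->] := mkE e1 e2 false.
Qed.

Lemma fsum_nil H : fsum [::] H = H [::] [::].
Proof.
rewrite /fsum (bigD1 (set0 : {set fedge [::]})) //= big1 ?addr0 // => e.
by rewrite [e]set_void eqxx.
Qed.

Lemma fsum_cons t F H :
  fsum (t :: F) H =
  tsum t (fun p o c => fsum F (fun a b => H (p :: o ++ a) (c :: b))).
Proof.
pose E := {set edge t + fedge F}.
pose mk (x : {set edge t} * {set fedge F}) : E :=
  [set y | match y with inl y => y \in x.1 | inr y => y \in x.2 end].
pose un (e : E) := (inl @^-1: e, inr @^-1: e).
have unK x : un (mk x) = x.
  by case: x => [e1 e2]; congr (_, _); apply/setP => y; rewrite !inE.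
have mkK e : mk (un e) = e by apply/setP => -[y|y]; rewrite /mk /un !inE.
rewrite /fsum (reindex mk) /=; last by exists un => x _; [exact: unK|exact: mkK].
rewrite /tsum pair_bigA; apply: eq_bigr => -[e1 e2] _ /=.
by have [-> ->] := unK (e1, e2).
Qed.

Lemma mergeA s t u : merge s (merge t u) = merge (merge s t) u.
Proof. by elim: s => //= d s _ s' ->. Qed.

Lemma tsum_merge s t G :
  tsum (merge s t) G =
  tsum s (fun p o c => tsum t (fun p' o' c' =>
    G (merge p p') (o ++ o') (merge c c'))).
Proof.
elim: s G => [|d s1 _ s2 IH] G /=; first by rewrite tsum_Dot.
rewrite !tsum_Graft; apply: eq_tsum => p1 o1 c1; rewrite IH.
apply: eq_tsum => p2 o2 c2; rewrite -tsumD; apply: eq_tsum => p o c.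
by rewrite /= -!catA mergeA.
Qed.

Lemma fsum_cat F F' H :
  fsum (F ++ F') H =
  fsum F (fun a b => fsum F' (fun a' b' => H (a ++ a') (b ++ b'))).
Proof.
elim: F H => [|t F IH] H /=; first by rewrite fsum_nil.
rewrite !fsum_cons; apply: eq_tsum => p o c; rewrite IH.
by apply: eq_fsum => a b; apply: eq_fsum => a' b'; rewrite /= catA.
Qed.

End CutSums.

(** * Isomorphism classes of trees and forests, and invariance of the sums *)

Section ForestClass.
Variable D : choiceType.
Implicit Types (s t : ptree D) (F : seq (ptree D)).

Lemma card_edge_Graft d s t :
  #|edge (Graft d s t)| = (#|edge s| + #|edge t|).+1.
Proof. by rewrite card_option card_sum. Qed.

Lemma card_edge_iso t t' : ptree_iso t t' -> #|edge t| = #|edge t'|.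
Proof.
elim=> {t t'} [//|t u _ -> //|t u v _ -> _ -> //|d s s' u u' _ es _ eu|
  d1 s1 d2 s2 u].
  by rewrite !card_edge_Graft es eu.
by rewrite !card_edge_Graft !addnS addnCA.
Qed.

Lemma eqpi_iso t t' : (\pi_(tree D) t == \pi_(tree D) t') = ptree_isob t t'.
Proof. by rewrite piE. Qed.

Lemma iso_repr t : ptree_iso t (repr (\pi_(tree D) t)).
Proof.
apply/asboolP; change (ptree_isob t (repr (\pi_(tree D) t))).
by rewrite -eqpi_iso reprK.
Qed.

Lemma iso_pi t t' : ptree_iso t t' -> \pi_(tree D) t = \pi_(tree D) t'.
Proof. by move=> /asboolP tt'; apply/eqP; rewrite eqpi_iso. Qed.

Lemma forest_class_nil : forest_class [::] = mone :> forest D.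
Proof. by rewrite /forest_class big_nil. Qed.

Definition tree_class t : forest D :=
  oapp (@forest_of_tree D) mone (insub (\pi_(tree D) t)).

Lemma forest_class_cons t F :
  forest_class (t :: F) = mmul (tree_class t) (forest_class F).
Proof. by rewrite /forest_class big_cons. Qed.

Lemma forest_class_cat F F' :
  forest_class (F ++ F') = mmul (forest_class F) (forest_class F').
Proof. by rewrite /forest_class big_cat. Qed.

Definition forest_classE :=
  (forest_class_nil, forest_class_cons, forest_class_cat, @mulmA (forest D),
   @mulm1 (forest D), @mul1m (forest D)).

Lemma tree_class_iso t t' : ptree_iso t t' -> tree_class t = tree_class t'.
Proof. by rewrite /tree_class => /iso_pi ->. Qed.

Lemma tree_class_repr (x : etree D) : tree_class (repr (val x)) = forest_of_tree x.
Proof. by rewrite /tree_class reprK valK. Qed.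

(** Turns the tests for the unit that come from the counit into edge counts, which are additive
    under grafting and merging. *)
Lemma tree_class_eq1 t : (tree_class t == mone) = (#|edge t| == 0%N).
Proof.
rewrite /tree_class; case: insubP => [x x_gt0 xE|] /=.
  rewrite cm1_eq1; apply/esym/negbTE; rewrite -lt0n.
  by rewrite (card_edge_iso (iso_repr t)).
by rewrite eqxx -eqn0Ngt -(card_edge_iso (iso_repr t)) => ->.
Qed.

Lemma tree_class_Dot : tree_class Dot = mone.
Proof. by apply/eqP; rewrite tree_class_eq1 card_void. Qed.

Lemma merge_Graft d s t u :
  ptree_iso (merge t (Graft d s u)) (Graft d s (merge t u)).
Proof.
elim: t => [|d1 s1 _ t IH] /=; first exact: iso_refl.
by apply: iso_trans (iso_swap _ _ _ _ _); apply: iso_graft IH; apply: iso_refl.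
Qed.

Lemma mergeD t : merge t Dot = t.
Proof. by elim: t => //= d s _ t ->. Qed.

Lemma merge_comm s t : ptree_iso (merge s t) (merge t s).
Proof.
elim: s => [|d s1 _ s IH] /=; first by rewrite mergeD; apply: iso_refl.
apply: iso_trans (iso_sym (merge_Graft _ _ _ _)).
by apply: iso_graft IH; apply: iso_refl.
Qed.

Lemma merge_iso_r s t t' : ptree_iso t t' -> ptree_iso (merge s t) (merge s t').
Proof.
by move=> tt'; elim: s => //= d s _ s' IH; apply: iso_graft IH; apply: iso_refl.
Qed.

Lemma merge_iso s s' t t' :
  ptree_iso s s' -> ptree_iso t t' -> ptree_iso (merge s t) (merge s' t').
Proof.
move=> ss' tt'; apply: iso_trans (merge_iso_r s' tt').
apply: iso_trans (merge_comm _ _) _; apply: iso_trans (merge_comm _ _).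
exact: merge_iso_r.
Qed.

(** A finite multiset listed with multiplicities: [forest_repr] before the choice of plane
    representatives. *)
Definition forest_trees (A : forest D) : seq (etree D) :=
  flatten [seq nseq (A x) x | x <- finsupp A].

Lemma forest_reprE (A : forest D) :
  forest_repr A = [seq repr (val x) | x <- forest_trees A].
Proof.
rewrite /forest_repr /forest_trees map_flatten -map_comp.
by congr flatten; apply: eq_map => x /=; rewrite map_nseq.
Qed.

Lemma count_forest_trees (A : forest D) x : count_mem x (forest_trees A) = A x.
Proof.
rewrite /forest_trees count_flatten -map_comp sumnE big_map.
under eq_bigr => y _ do rewrite /= count_nseq /=.
have [xA|xNA] := boolP (x \in finsupp A).
  rewrite (bigD1_seq x) ?fset_uniq //= eqxx mul1n big1 ?addn0 // => y /negbTE yx.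
  by rewrite yx.
rewrite big_seq big1 => [|y yA]; first by apply/esym/eqP; rewrite cmE_eq0.
by case: eqVneq => // yx; rewrite -yx yA in xNA.
Qed.

Lemma forest_trees_bigop (s : seq (etree D)) :
  perm_eq (forest_trees (\big[mmul/mone]_(x <- s) forest_of_tree x)) s.
Proof.
apply/allP => x _ /=; rewrite count_forest_trees; apply/eqP.
elim: s => [|y s IH]; first by rewrite big_nil cm1.
by rewrite big_cons cmM IH cmU.
Qed.

Lemma forest_treesK (A : forest D) :
  \big[mmul/mone]_(x <- forest_trees A) forest_of_tree x = A.
Proof.
apply/eqP/cmP => x; rewrite -!count_forest_trees.
exact: (permP (forest_trees_bigop _)).
Qed.

Lemma forest_class_bigop F :
  forest_class F = \big[mmul/mone]_(x <- pmap (fun t => insub (\pi_(tree D) t)) F)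
    forest_of_tree x.
Proof.
elim: F => [|t F IH]; first by rewrite forest_class_nil big_nil.
rewrite forest_class_cons IH /tree_class /=; case: insub => [x|] /=.
  by rewrite big_cons.
by rewrite mul1m.
Qed.

Lemma forest_reprK (A : forest D) : forest_class (forest_repr A) = A.
Proof.
rewrite -[RHS]forest_treesK forest_reprE.
elim: (forest_trees A) => [|x s IH]; first by rewrite forest_class_nil big_nil.
by rewrite /= forest_class_cons tree_class_repr IH big_cons.
Qed.

Ltac forest_ac := rewrite !forest_classE; apply/eqP/cmP => ?; rewrite !cmM; lia.

Section Invariance.
Variable V : nmodType.

(** Induction on the isomorphism. The invariance required of [G] passes to the inner sums because
    grafting and merging respect isomorphism; the essential case is the exchange of two siblings. *)
Lemma tsum_iso t t' (G : ptree D -> seq (ptree D) -> ptree D -> V) :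
  (forall p p' o o' c c', ptree_iso p p' -> forest_class o = forest_class o' ->
     ptree_iso c c' -> G p o c = G p' o' c') ->
  ptree_iso t t' -> tsum t G = tsum t' G.
Proof.
move=> + tt'; elim: tt' G => [//|u v _ IH|u v w _ IH1 _ IH2|
    d s s' u u' _ IHs _ IHu|d1 s1 d2 s2 u] G eqG.
- by rewrite IH.
- by rewrite IH1 // IH2.
- rewrite !tsum_Graft; rewrite IHs; last first.
    move=> p p' o o' c c' pp' oo' cc'; apply: eq_tsum => q r b.
    congr (_ + _); apply: eqG.
    + by apply: iso_graft => //; apply: iso_refl.
    + by rewrite !forest_class_cat oo'.
    + by apply: merge_iso => //; apply: iso_refl.
    + exact: iso_refl.
    + by rewrite !forest_classE oo' (tree_class_iso pp').
    + by apply: iso_graft => //; apply: iso_refl.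
  apply: eq_tsum => p o c; apply: IHu => q q' r r' b b' qq' rr' bb'.
  congr (_ + _); apply: eqG.
  + by apply: iso_graft => //; apply: iso_refl.
  + by rewrite !forest_class_cat rr'.
  + by apply: merge_iso => //; apply: iso_refl.
  + by [].
  + by rewrite !forest_classE rr'.
  + by apply: iso_graft => //; apply: iso_refl.
rewrite !tsum_Graft; under eq_tsum => p1 o1 c1 do rewrite tsum_Graft.
rewrite tsum_exchange; apply: eq_tsum => p2 o2 c2.
rewrite tsum_Graft; apply: eq_tsum => p1 o1 c1; apply: eq_tsum => p o c.
(* Each of the two sibling edges is selected or not, which gives four terms; the exchange permutes
   the two mixed ones. *)
rewrite addrACA; congr (_ + _ + (_ + _)); apply: eqG => /=;
  rewrite ?mergeA; do ?[exact: iso_refl | exact: iso_swap | forest_ac].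
- by apply: merge_iso (iso_refl _); apply: merge_comm.
- exact: merge_Graft.
- exact: iso_sym (merge_Graft _ _ _ _).
Qed.

Lemma fsum_perm F F' (H : forest D -> forest D -> V) : perm_eq F F' ->
  fsum F (fun a b => H (forest_class a) (forest_class b)) =
  fsum F' (fun a b => H (forest_class a) (forest_class b)).
Proof.
move=> FF'; pose P F' := fsum F (fun a b => H (forest_class a) (forest_class b)) =
  fsum F' (fun a b => H (forest_class a) (forest_class b)).
apply: (@catCA_perm_ind _ P _ _ _ FF') => // F1 F2 F3; rewrite /P => ->.
rewrite !fsum_cat; under eq_fsum => a b do rewrite fsum_cat.
rewrite fsum_exchange; apply: eq_fsum => a2 b2; rewrite fsum_cat.
apply: eq_fsum => a1 b1; apply: eq_fsum => a b.
by congr H; forest_ac.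
Qed.

(** Any forest can be normalized without changing the sum, by deleting isolated vertices and passing
    to chosen representatives; normalized forests of the same class differ by a permutation. *)
Lemma fsum_class F F' (H : forest D -> forest D -> V) :
  forest_class F = forest_class F' ->
  fsum F (fun a b => H (forest_class a) (forest_class b)) =
  fsum F' (fun a b => H (forest_class a) (forest_class b)).
Proof.
pose red F : seq (ptree D) :=
  [seq repr (val x) |
    x <- pmap (fun t => insub (\pi_(tree D) t) : option (etree D)) F].
have redE F0 : fsum F0 (fun a b => H (forest_class a) (forest_class b)) =
    fsum (red F0) (fun a b => H (forest_class a) (forest_class b)).
  elim: F0 H => [//|t F0 IH] H'; rewrite /red /=.
  (* The induction hypothesis is used for [H'] translated by the classes that the head tree
     contributes. *)
  have {}IH (p : ptree D) (o : seq (ptree D)) (c : ptree D) :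
      fsum F0 (fun a b =>
        H' (forest_class (p :: o ++ a)) (forest_class (c :: b))) =
      fsum (red F0) (fun a b =>
        H' (forest_class (p :: o ++ a)) (forest_class (c :: b))).
    have := IH (fun A B => H' (mmul (forest_class (p :: o)) A)
                              (mmul (tree_class c) B)).
    under eq_fsum => a b do rewrite -forest_class_cat -forest_class_cons.
    under [RHS]eq_fsum => a b do rewrite -forest_class_cat -forest_class_cons.
    by [].
  rewrite fsum_cons; under eq_tsum => p o c do rewrite IH.
  case: insubP => [x _ xE|] /=.
    rewrite fsum_cons; apply: tsum_iso.
      move=> p p' o o' c c' pp' oo' cc'; apply: eq_fsum => a b.
      by rewrite !forest_classE oo' (tree_class_iso pp') (tree_class_iso cc').
    by rewrite xE; apply: iso_repr.
  rewrite -eqn0Ngt -(card_edge_iso (iso_repr t)).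
  case: t => [_|d s t]; last by rewrite card_edge_Graft.
  rewrite tsum_Dot; apply: eq_fsum => a b /=.
  by rewrite !forest_classE tree_class_Dot !mul1m.
move=> FF'; rewrite redE [RHS]redE; apply: fsum_perm; apply: perm_map.
rewrite -(permPl (forest_trees_bigop _)) -forest_class_bigop FF'.
by rewrite forest_class_bigop forest_trees_bigop.
Qed.

(* Both sides sum over the pairs of nested sets of edges.  Plane representatives
   suffice for the three trees that contain the root; the other components have
   to be reordered, hence are taken in [forest D]. *)
Lemma tsum_coassoc t
    (H : ptree D -> forest D -> ptree D -> forest D -> ptree D -> V) :
  tsum t (fun p o c => tsum p (fun p1 o1 p2 => fsum o (fun a b =>
    H p1 (forest_class (o1 ++ a)) p2 (forest_class b) c))) =
  tsum t (fun p o c => tsum c (fun p2 o2 c2 =>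
    H p (forest_class o) p2 (forest_class o2) c2)).
Proof.
elim: t H => [|d s IHs t IHt] H.
  by rewrite !tsum_Dot fsum_nil.
(* The three terms are the positions of the root edge relative to two nested edge sets: in the
   smaller one, in the larger one only, in neither. Both sides are brought to a sum of [X] over [s]
   and [t]. *)
pose X p1s f1s p2s f2s cs p1t f1t p2t f2t ct :=
  H (Graft d p1s p1t) (mmul f1s f1t) (merge p2s p2t) (mmul f2s f2t) (merge cs ct) +
  H p1t (mmul (mmul (tree_class p1s) f1s) f1t)
    (Graft d p2s p2t) (mmul f2s f2t) (merge cs ct) +
  H p1t (mmul (mmul (tree_class p1s) f1s) f1t)
    p2t (mmul (mmul (tree_class p2s) f2s) f2t) (Graft d cs ct).
transitivity (tsum s (fun ps os cs => tsum ps (fun p1s o1s p2s => fsum os (fun a b =>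
    tsum t (fun pt ot ct => tsum pt (fun p1t o1t p2t => fsum ot (fun a' b' =>
      X p1s (forest_class (o1s ++ a)) p2s (forest_class b) cs
        p1t (forest_class (o1t ++ a')) p2t (forest_class b') ct))))))).
  rewrite tsum_Graft; apply: eq_tsum => ps os cs.
  under [RHS]eq_tsum => p1s o1s p2s do rewrite -tfsum_exchange.
  rewrite [RHS]tsum_exchange; apply: eq_tsum => pt ot ct.
  under [X in _ + X]eq_tsum => p1t o1t p2t do rewrite fsum_cons.
  rewrite tsum_Graft [X in _ + X]tsum_exchange -tsumD.
  apply: eq_tsum => p1s o1s p2s; rewrite -tsumD -tfsum_exchange.
  apply: eq_tsum => p1t o1t p2t; rewrite -!fsumD fsum_cat.
  apply: eq_fsum => a b; apply: eq_fsum => a' b'; rewrite /X.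
  congr (_ + _ + _); congr H; forest_ac.
rewrite [RHS]tsum_Graft.
transitivity (tsum s (fun ps os cs => tsum cs (fun p2s o2s c2s =>
    tsum t (fun pt ot ct => tsum ct (fun p2t o2t c2t =>
      X ps (forest_class os) p2s (forest_class o2s) c2s
        pt (forest_class ot) p2t (forest_class o2t) c2t))))).
  (* The whole sum over [t] is absorbed into the function to which the hypothesis on [s] applies;
     the hypothesis on [t] then acts inside. *)
  rewrite (IHs (fun p1s f1s p2s f2s cs => tsum t (fun pt ot ct =>
      tsum pt (fun p1t o1t p2t => fsum ot (fun a' b' => X p1s f1s p2s f2s cs
        p1t (forest_class (o1t ++ a')) p2t (forest_class b') ct))))).
  apply: eq_tsum => ps os cs; apply: eq_tsum => p2s o2s c2s.
  exact: (IHt (X ps (forest_class os) p2s (forest_class o2s) c2s)).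
apply: eq_tsum => ps os cs; rewrite tsum_exchange; apply: eq_tsum => pt ot ct.
rewrite tsum_merge tsum_Graft -tsumD; apply: eq_tsum => p2s o2s c2s.
rewrite -tsumD; apply: eq_tsum => p2t o2t c2t.
by rewrite /X -addrA; congr (_ + (_ + _)); congr H; forest_ac.
Qed.

End Invariance.
End ForestClass.

(** * The coproduct of forests: grading, multiplicativity, coassociativity, counit *)

Section ForestCoproduct.
Variable D : choiceType.
Implicit Types (s t : ptree D) (F : seq (ptree D)) (A B P C : forest D).

Lemma card_edge_merge s t : #|edge (merge s t)| = (#|edge s| + #|edge t|)%N.
Proof.
elim: s => [|d s1 _ s2 IH]; first by rewrite card_void.
by rewrite [merge _ _]/= !card_edge_Graft IH addnA.
Qed.

Lemma card_fedge_cons t F : #|fedge (t :: F)| = (#|edge t| + #|fedge F|)%N.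
Proof. by rewrite card_sum. Qed.

Lemma card_fedge_cat F F' : #|fedge (F ++ F')| = (#|fedge F| + #|fedge F'|)%N.
Proof.
elim: F => [|t F IH]; first by rewrite card_void.
by rewrite cat_cons !card_fedge_cons IH addnA.
Qed.

Lemma card_edge_part t (e : {set edge t}) :
  (#|fedge ((part e).1 :: (part e).2)| + #|edge (cont e)|)%N = #|edge t|.
Proof.
elim: t e => [|d s IHs t IHt] e; first by rewrite card_fedge_cons !card_void.
rewrite card_edge_Graft -(IHs (edgesl e)) -(IHt (edgesr e)) /=.
case: ifP => _; rewrite ?card_edge_merge ?card_edge_Graft /=;
  rewrite !(card_sum, card_option, card_fedge_cat); lia.
Qed.

Lemma card_fedge_part F (e : {set fedge F}) :
  (#|fedge (fpart e)| + #|fedge (fcont e)|)%N = #|fedge F|.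
Proof.
elim: F e => [|t F IH] e; first by rewrite /= card_void.
pose p := part (inl @^-1: e).
have -> : fpart e = p.1 :: p.2 ++ fpart (inr @^-1: e) by [].
have -> : fcont e = cont (inl @^-1: e) :: fcont (inr @^-1: e) by [].
rewrite [RHS]card_fedge_cons -(IH (inr @^-1: e)) -(card_edge_part (inl @^-1: e)).
rewrite !(card_fedge_cons, card_fedge_cat) -!addnA; congr (_ + (_ + _))%N.
exact: addnCA.
Qed.

Definition fdegree A : nat := \sum_(x <- forest_trees A) #|edge (repr (val x))|.

Lemma fdegree_class F : fdegree (forest_class F) = #|fedge F|.
Proof.
rewrite /fdegree forest_class_bigop (perm_big _ (forest_trees_bigop _)) /=.
elim: F => [|t F IH]; first by rewrite big_nil card_void.
rewrite card_fedge_cons -IH /=; case: insubP => [x _ xE|] /=.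
  by rewrite big_cons xE -(card_edge_iso (iso_repr t)).
by rewrite -eqn0Ngt -(card_edge_iso (iso_repr t)) => /eqP ->.
Qed.

Section Sums.
Variable V : nmodType.
Implicit Type H : forest D -> forest D -> V.

(** The coproduct of [A] paired with an arbitrary function [H]. Bialgebra identities stated for all
    [H] need no iterated tensor products. *)
Definition csum A H : V := \sum_(e : {set fedge (forest_repr A)})
  H (forest_class (fpart e)) (forest_class (fcont e)).

Lemma csum_class F H :
  csum (forest_class F) H =
  fsum F (fun a b => H (forest_class a) (forest_class b)).
Proof. by apply: fsum_class; rewrite forest_reprK. Qed.

(** The coproduct is homogeneous for the number of edges, so only pairs of complementary degrees
    matter. *)
Lemma eq_csum A H H' :
  (forall P C, (fdegree P + fdegree C)%N = fdegree A -> H P C = H' P C) ->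
  csum A H = csum A H'.
Proof.
move=> eqH; apply: eq_bigr => e _; apply: eqH.
by rewrite !fdegree_class card_fedge_part -fdegree_class forest_reprK.
Qed.

Lemma csumD A H H' :
  csum A (fun P C => H P C + H' P C) = csum A H + csum A H'.
Proof. exact: big_split. Qed.

Lemma csum_exchange A B (H : forest D -> forest D -> forest D -> forest D -> V) :
  csum A (fun P C => csum B (H P C)) =
  csum B (fun P' C' => csum A (fun P C => H P C P' C')).
Proof. exact: exchange_big. Qed.

Lemma csumM A B H :
  csum (mmul A B) H =
  csum A (fun P C => csum B (fun P' C' => H (mmul P P') (mmul C C'))).
Proof.
rewrite -[A in LHS]forest_reprK -[B in LHS]forest_reprK -forest_class_cat.
rewrite csum_class fsum_cat; apply: eq_bigr => e _; apply: eq_bigr => e' _.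
by rewrite !forest_classE.
Qed.

(** Induction on the list of trees: [tsum_coassoc] treats the head, and the sum over the tail is
    packed into its argument as [H']. *)
Lemma csum_coassoc A (H : forest D -> forest D -> forest D -> V) :
  csum A (fun P C => csum P (fun P1 P2 => H P1 P2 C)) =
  csum A (fun P C => csum C (fun C1 C2 => H P C1 C2)).
Proof.
rewrite -(forest_reprK A) !csum_class; move: (forest_repr A) => F.
under eq_fsum => a b do rewrite csum_class.
under [RHS]eq_fsum => a b do rewrite csum_class.
elim: F H => [|t F IH] H; first by rewrite !fsum_nil.
pose H' p1 f1 p2 f2 c := fsum F (fun a b => fsum a (fun a1 a2 =>
  H (mmul (mmul (tree_class p1) f1) (forest_class a1))
    (mmul (mmul (tree_class p2) f2) (forest_class a2))
    (mmul (tree_class c) (forest_class b)))).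
transitivity (tsum t (fun p o c => tsum p (fun p1 o1 p2 => fsum o (fun a b =>
    H' p1 (forest_class (o1 ++ a)) p2 (forest_class b) c)))).
  rewrite fsum_cons; apply: eq_tsum => p o c.
  under eq_fsum => a b do rewrite fsum_cons.
  rewrite -tfsum_exchange; apply: eq_tsum => p1 o1 p2.
  under eq_fsum => a b do rewrite fsum_cat.
  rewrite fsum_exchange; apply: eq_fsum => x y; rewrite /H'.
  apply: eq_fsum => a b; apply: eq_fsum => a1 a2.
  by rewrite !forest_classE.
rewrite tsum_coassoc fsum_cons; apply: eq_tsum => p o c.
under [RHS]eq_fsum => a b do rewrite fsum_cons.
rewrite -tfsum_exchange; apply: eq_tsum => p2 o2 c2.
rewrite /H' (IH (fun A1 A2 B => H (mmul (mmul (tree_class p) (forest_class o)) A1)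
    (mmul (mmul (tree_class p2) (forest_class o2)) A2) (mmul (tree_class c2) B))).
by apply: eq_fsum => a b; apply: eq_fsum => b1 b2; rewrite !forest_classE.
Qed.

Lemma tsum_cond t (b : bool) (G : ptree D -> seq (ptree D) -> ptree D -> V) :
  tsum t (fun p o c => if b then G p o c else 0) = if b then tsum t G else 0.
Proof. by case: b => //; apply: big1. Qed.

Lemma fsum_cond F (b : bool) (G : seq (ptree D) -> seq (ptree D) -> V) :
  fsum F (fun x y => if b then G x y else 0) = if b then fsum F G else 0.
Proof. by case: b => //; apply: big1. Qed.

(** Only the empty edge set leaves nothing but isolated vertices, and contracting it changes
    nothing. *)
Lemma csum_counitl A (h : forest D -> V) :
  csum A (fun P C => if P == mone then h C else 0) = h A.
Proof.
(* [G] ranges over all functions of plane trees, so that the induction can use it precomposed with a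
   grafting. *)
have tree t (G : ptree D -> V) :
    tsum t (fun p o c => if forest_class (p :: o) == mone then G c else 0) = G t.
  elim: t G => [|d s IHs t IHt] G.
    by rewrite tsum_Dot !forest_classE tree_class_Dot eqxx.
  rewrite tsum_Graft -[RHS](IHs (fun s' => G (Graft d s' t))).
  apply: eq_tsum => p o c; rewrite -[G _](IHt (fun t' => G (Graft d c t'))).
  rewrite -tsum_cond; apply: eq_tsum => p' o' c'.
  rewrite [in X in X + _]forest_class_cons cmM_eq1 tree_class_eq1.
  rewrite card_edge_Graft add0r !forest_classE !cmM_eq1.
  by case: (_ == _); case: (_ == _); case: (_ == _); rewrite ?andbF.
rewrite -(forest_reprK A) csum_class; move: (forest_repr A) => F.
suff -> (G : seq (ptree D) -> V) :
    fsum F (fun a b => if forest_class a == mone then G b else 0) = G F by [].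
elim: F G => [|t F IH] G; first by rewrite fsum_nil forest_class_nil eqxx.
rewrite fsum_cons -[RHS](tree t (fun t' => G (t' :: F))); apply: eq_tsum => p o c.
rewrite -[G _](IH (fun F' => G (c :: F'))) -fsum_cond.
apply: eq_fsum => a b; rewrite !forest_classE !cmM_eq1.
by case: (_ == _); case: (_ == _); case: (_ == _).
Qed.

(** Dually, only the full edge set contracts everything to isolated vertices. *)
Lemma csum_counitr A (h : forest D -> V) :
  csum A (fun P C => if C == mone then h P else 0) = h A.
Proof.
have tree t (G : ptree D -> seq (ptree D) -> V) :
    tsum t (fun p o c => if tree_class c == mone then G p o else 0) = G t [::].
  elim: t G => [|d s IHs t IHt] G.
    by rewrite tsum_Dot tree_class_Dot eqxx.
  (* The empty list is appended to match what the hypothesis on [t] yields for [o ++ o']. *)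
  rewrite tsum_Graft -[RHS](IHs (fun s' o => G (Graft d s' t) (o ++ [::]))).
  apply: eq_tsum => p o c.
  rewrite -[G _ _](IHt (fun t' o' => G (Graft d p t') (o ++ o'))).
  rewrite -tsum_cond; apply: eq_tsum => p' o' c'.
  rewrite !tree_class_eq1 card_edge_Graft addr0 card_edge_merge addn_eq0.
  by case: (_ == _); case: (_ == _).
rewrite -(forest_reprK A) csum_class; move: (forest_repr A) => F.
suff -> (G : seq (ptree D) -> V) :
    fsum F (fun a b => if forest_class b == mone then G a else 0) = G F by [].
elim: F G => [|t F IH] G; first by rewrite fsum_nil forest_class_nil eqxx.
rewrite fsum_cons -[RHS](tree t (fun t' o => G (t' :: o ++ F))).
apply: eq_tsum => p o c; rewrite -[G _](IH (fun F' => G (p :: o ++ F'))) -fsum_cond.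
by apply: eq_fsum => a b; rewrite forest_class_cons cmM_eq1; case: (_ == _).
Qed.

End Sums.
End ForestCoproduct.

(** * Linear extension and coefficients in free modules *)

Section FreeModuleTheory.
Variable K : fieldType.
Implicit Types A B : choiceType.

(** Allows several vectors to be summed over one common index set, as linearity demands. *)
Lemma linextEw A (V : lmodType K) (f : A -> V) (x : {malg K[A]}) (S : {fset A}) :
  (msupp x `<=` S)%fset -> linext f x = \sum_(a <- S) x@_a *: f a.
Proof.
move=> xS; rewrite /linext (big_fset_incl _ xS) //= => a _ /mcoeff_outdom ->.
by rewrite scale0r.
Qed.

Lemma linextU A (V : lmodType K) (f : A -> V) a : linext f << a >> = f a.
Proof. by rewrite (linextEw f msuppU_le) big_seq_fset1 mcoeffUU scale1r. Qed.

Lemma linext_is_linear A (V : lmodType K) (f : A -> V) : linear (linext f).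
Proof.
move=> k x y; pose S := (msupp x `|` msupp y)%fset.
rewrite (@linextEw _ _ _ x S) ?fsubsetUl // (@linextEw _ _ _ y S) ?fsubsetUr //.
rewrite (@linextEw _ _ _ _ S); last first.
  apply: fsubset_trans (msuppD_le _ _) _; apply: fsetSU; exact: msuppZ_le.
rewrite scaler_sumr -big_split /=; apply: eq_bigr => a _.
by rewrite mcoeffD mcoeffZ scalerDl scalerA.
Qed.

HB.instance Definition _ A (V : lmodType K) (f : A -> V) :=
  GRing.isLinear.Build K {malg K[A]} V *:%R (linext f) (linext_is_linear f).

Lemma eq_linear_malg A (V : lmodType K) (f g : {malg K[A]} -> V) :
  linear f -> linear g -> (forall a, f << a >> = g << a >>) -> f =1 g.
Proof.
move=> lf lg fg x.
pose f' : {linear {malg K[A]} -> V} := HB.pack f (GRing.isLinear.Build _ _ _ _ f lf).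
pose g' : {linear {malg K[A]} -> V} := HB.pack g (GRing.isLinear.Build _ _ _ _ g lg).
have scaleU a : << x@_a *g a >> = x@_a *: << a >> :> {malg K[A]}.
  by apply/malgP => b; rewrite mcoeffZ !mcoeffU mulrnAr mulr1.
suff: f' x = g' x by [].
rewrite (monalgE x) !linear_sum; apply: eq_bigr => a _.
by rewrite scaleU !linearZ /=; congr (_ *: _); apply: fg.
Qed.

Lemma mcoeff_linext A B (f : A -> {malg K[B]}) x b :
  (linext f x)@_b = \sum_(a <- msupp x) x@_a * (f a)@_b.
Proof. by rewrite /linext raddf_sum; apply: eq_bigr => a _; rewrite /= mcoeffZ. Qed.

(** A sum against a Kronecker delta; the coefficient formulas for tensors, words and letters all
    reduce to it. *)
Lemma sum_mcoeffU A (x : {malg K[A]}) (h : A -> K) a :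
  \sum_(b <- msupp x) x@_b * (h b *+ (b == a)) = x@_a * h a.
Proof.
have [ax|ax] := boolP (a \in msupp x).
  rewrite (bigD1_seq a) ?fset_uniq //= eqxx big1 ?addr0 // => b /negbTE ->.
  by rewrite mulr0.
rewrite (mcoeff_outdom ax) mul0r big_seq big1 // => b bx.
by case: eqVneq => [ba|]; rewrite ?mulr0 // -ba bx in ax *.
Qed.

Lemma mcoeff_tens A B (x : {malg K[A]}) (y : {malg K[B]}) a b :
  (tens x y)@_(a, b) = x@_a * y@_b.
Proof.
rewrite /tens mcoeff_linext -(sum_mcoeffU x (fun=> y@_b)); apply: eq_bigr => a' _.
congr (_ * _); rewrite mcoeff_linext.
under eq_bigr => b' _ do rewrite mcoeffU xpair_eqE -mulnb mulrnA.
case: (a' == a); last by rewrite big1 // => b' _; rewrite mulr0n mul0rn mulr0.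
by rewrite (sum_mcoeffU y (fun=> 1)) mulr1.
Qed.

End FreeModuleTheory.

(** * Coefficients of the shuffle product and of deconcatenation *)

Section ShuffleAlgebra.
Variables (K : fieldType) (D : choiceType).
Implicit Types (x y : Sh K D) (d : D) (u v w : seq D).

Lemma Sh_mul_linearl k x1 x2 y :
  Sh_mul (k *: x1 + x2) y = k *: Sh_mul x1 y + Sh_mul x2 y.
Proof. exact: linearP. Qed.

Lemma Sh_mul_linearr k x y1 y2 :
  Sh_mul x (k *: y1 + y2) = k *: Sh_mul x y1 + Sh_mul x y2.
Proof.
have E z : Sh_mul x z = \sum_(u <- msupp x)
    x@_u *: linext (fun v => \sum_(w <- shuffle u v) << w >>) z by [].
rewrite !E scaler_sumr -big_split; apply: eq_bigr => u _ /=.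
by rewrite linearP scalerDr !scalerA mulrC.
Qed.

HB.instance Definition _ x :=
  GRing.isLinear.Build K (Sh K D) (Sh K D) *:%R (Sh_mul x)
    (fun k => Sh_mul_linearr k x).

Lemma Sh_mulU u v :
  Sh_mul << u >> << v >> = \sum_(w <- shuffle u v) << w >> :> Sh K D.
Proof. by rewrite /Sh_mul !linextU. Qed.

(** Left division by a letter, the transpose of prefixing [d]: it allows induction on the word whose
    coefficient is read. *)
Definition Sh_ldiv d : Sh K D -> Sh K D :=
  linext (fun w => if w is a :: w' then << w' >> *+ (a == d) else 0).

HB.instance Definition _ d := GRing.Linear.on (Sh_ldiv d).

Lemma mcoeff_ldiv d x w : (Sh_ldiv d x)@_w = x@_(d :: w).
Proof.
rewrite /Sh_ldiv mcoeff_linext -[RHS]mulr1 -(sum_mcoeffU x (fun=> 1)).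
apply: eq_bigr => -[|a w'] _; congr (_ * _); first by rewrite mcoeff0.
by rewrite mcoeffMn mcoeffU eqseq_cons -mulrnA mulnb andbC.
Qed.

(** Left division is a derivation, because the first letter of a shuffle is the first letter of one
    of the two factors. *)
Lemma Sh_ldiv_mul d x y :
  Sh_ldiv d (Sh_mul x y) = Sh_mul (Sh_ldiv d x) y + Sh_mul x (Sh_ldiv d y).
Proof.
move: x; apply: eq_linear_malg => [k x1 x2|k x1 x2|u] /=.
- by rewrite Sh_mul_linearl linearP.
- by rewrite linearP !Sh_mul_linearl scalerDr addrACA.
move: y; apply: eq_linear_malg => [k y1 y2|k y1 y2|v] /=.
- by rewrite !linearP.
- by rewrite !linearP scalerDr addrACA.
have ldivU w : Sh_ldiv d << w >> =
    if w is a :: w' then << w' >> *+ (a == d) else 0.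
  by rewrite /Sh_ldiv linextU.
have mulr1 w : Sh_mul << w >> << [::] >> = << w >> :> Sh K D.
  by rewrite Sh_mulU; case: w => [|a w]; rewrite /= big_seq1.
have mul1r w : Sh_mul << [::] >> << w >> = << w >> :> Sh K D.
  by rewrite Sh_mulU /= big_seq1.
have mul0r y : Sh_mul 0 y = 0 by exact: linear0.
have mulMnl (b : bool) x y : Sh_mul (x *+ b) y = Sh_mul x y *+ b.
  by case: b.
case: u v => [|a u] [|b v].
- by rewrite mulr1 !ldivU mul0r linear0 addr0.
- by rewrite mul1r !ldivU mul0r linearMn /= mul1r add0r.
- by rewrite mulr1 !ldivU linear0 addr0 mulMnl mulr1.
rewrite !ldivU mulMnl linearMn /= !Sh_mulU -!sumrMnl /= big_cat !big_map /=.
rewrite linearD !linear_sum.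
by congr (_ + _); apply: eq_bigr => w _; apply: ldivU.
Qed.

Lemma Sh_mul_counit x y : (Sh_mul x y)@_[::] = x@_[::] * y@_[::].
Proof.
have shuffle0 u v : (\sum_(w <- shuffle u v) << w >> : Sh K D)@_[::] =
    1 *+ ((v == [::]) && (u == [::])).
  case: u v => [|a u] [|b v]; rewrite /= ?big_seq1 ?mcoeffU //.
  rewrite raddf_sum big_cat !big_map /=.
  by rewrite !big1 ?addr0 // => w _; rewrite mcoeffU.
rewrite /Sh_mul mcoeff_linext -(sum_mcoeffU x (fun=> y@_[::])).
apply: eq_bigr => u _; congr (_ * _); rewrite mcoeff_linext.
under eq_bigr => v _ do rewrite shuffle0 -mulnb mulrnA.
case: (u == [::]); last by rewrite big1 // => v _; rewrite mulr0n mulr0.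
by rewrite (sum_mcoeffU y (fun=> 1)) mulr1.
Qed.

(** One-letter coefficients vanish on products of elements with zero counit; this is how [Sh_proj]
    kills such products. *)
Lemma mcoeff_Sh_mul_letter x y d :
  (Sh_mul x y)@_[:: d] = x@_[:: d] * y@_[::] + x@_[::] * y@_[:: d].
Proof.
rewrite -mcoeff_ldiv Sh_ldiv_mul mcoeffD.
by congr (_ + _); rewrite Sh_mul_counit mcoeff_ldiv.
Qed.

Lemma mcoeff_Sh_coprod x u v : (Sh_coprod x)@_(u, v) = x@_(u ++ v).
Proof.
rewrite /Sh_coprod mcoeff_linext -[RHS]mulr1 -(sum_mcoeffU x (fun=> 1)).
apply: eq_bigr => w _; congr (_ * _); rewrite raddf_sum /=.
under eq_bigr => i _ do rewrite mcoeffU.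
have [->|wuv] := eqVneq w (u ++ v).
  have ltu : (size u < (size (u ++ v)).+1)%N by rewrite ltnS size_cat leq_addr.
  (* Only the cut at position [size u] has [u] as its left part. *)
  rewrite (bigD1 (Ordinal ltu)) //= take_size_cat // drop_size_cat // eqxx.
  rewrite big1 ?addr0 // => i; rewrite -val_eqE /= => iu.
  case: eqP => // -[/(congr1 size) tu _]; case/eqP: iu.
  by rewrite -tu size_takel // -ltnS.
rewrite big1 // => i _; case: eqP => // -[tu dv].
by rewrite -tu -dv cat_take_drop eqxx in wuv.
Qed.

Lemma mcoeff_Sh_proj x d : (Sh_proj x)@_d = x@_[:: d].
Proof.
rewrite /Sh_proj mcoeff_linext -[RHS]mulr1 -(sum_mcoeffU x (fun=> 1)).
apply: eq_bigr => -[|a [|b w]] _; congr (_ * _);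
  rewrite ?mcoeff0 ?mcoeffU ?eqseq_cons ?andbT ?andbF //.
Qed.

Definition Sh_cons (a : {malg K[D]}) x : Sh K D :=
  linext (fun d => linext (fun w => << d :: w >>) x) a.

Lemma mcoeff_Sh_cons a x w :
  (Sh_cons a x)@_w = if w is d :: w' then a@_d * x@_w' else 0.
Proof.
rewrite /Sh_cons mcoeff_linext; case: w => [|d w].
  rewrite big1 // => b _; rewrite mcoeff_linext big1 ?mulr0 // => v _.
  by rewrite mcoeffU mulr0.
rewrite -(sum_mcoeffU a (fun=> x@_w)); apply: eq_bigr => b _; congr (_ * _).
rewrite mcoeff_linext.
under eq_bigr => v _ do rewrite mcoeffU eqseq_cons -mulnb mulnC mulrnA.
case: (b == d); last by rewrite big1 // => v _; rewrite mulr0n mulr0.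
by rewrite (sum_mcoeffU x (fun=> 1)) mulr1.
Qed.

End ShuffleAlgebra.

(** * Construction and uniqueness of the morphism *)

Section UniversalMorphism.
Variables (K : fieldType) (D : choiceType).
Variable phi : {linear {malg K[etree D]} -> {malg K[D]}}.
Implicit Types (A B P C F : forest D) (w : seq D) (d : D).

(** The forced value of [Sh_proj] after the morphism: [phi] on single trees, zero on the unit and on
    products of several trees. *)
Definition letter A : {malg K[D]} :=
  if forest_trees A is [:: x] then phi << x >> else 0.

Lemma forest_trees_nil A : (forest_trees A == [::]) = (A == mone).
Proof.
apply/eqP/eqP => [A0|->]; first by rewrite -(forest_treesK A) A0 big_nil.
by rewrite /forest_trees mdom1.
Qed.

Lemma size_forest_treesM A B :
  size (forest_trees (mmul A B)) = (size (forest_trees A) + size (forest_trees B))%N.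
Proof.
rewrite -size_cat; apply: perm_size; apply/allP => x _ /=.
by rewrite count_cat !count_forest_trees cmM.
Qed.

Lemma letter1 : letter mone = 0.
Proof.
have /eqP m1 : forest_trees (mone : forest D) == [::] by rewrite forest_trees_nil.
by rewrite /letter m1.
Qed.

Lemma letter_tree (x : etree D) : letter (forest_of_tree x) = phi << x >>.
Proof.
have := forest_trees_bigop [:: x]; rewrite big_seq1 /letter.
by move/perm_small_eq=> ->.
Qed.

(** [letter] is an infinitesimal character: when neither factor is the unit, the product contains at
    least two trees. *)
Lemma letterM A B :
  letter (mmul A B) =
  (if A == mone then letter B else 0) + (if B == mone then letter A else 0).
Proof.
have [->|A1] := eqVneq A mone.
  by rewrite mul1m letter1 if_same addr0.
have [->|B1] := eqVneq B mone; first by rewrite mulm1 add0r.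
rewrite addr0 /letter; move: A1 B1 (size_forest_treesM A B).
rewrite -!forest_trees_nil -!size_eq0.
by case: (forest_trees (mmul A B)) => [|x [|y s]] //=; lia.
Qed.

(* The coefficient of the word [d1 ... dn] in the image of [A] is the value at
   [A] of the convolution product of the functionals "coefficient of [di] in
   [letter]". *)
Fixpoint word_coef w A : K :=
  if w is d :: w' then csum A (fun P C => (letter P)@_d * word_coef w' C)
  else (A == mone)%:R.

Lemma word_coef1 d A : word_coef [:: d] A = (letter A)@_d.
Proof.
rewrite /= -(csum_counitr A (fun P => (letter P)@_d)); apply: eq_csum => P C _.
by case: (C == mone); rewrite ?mulr1 ?mulr0.
Qed.

Lemma csum_mulr A (H : forest D -> forest D -> K) k :
  csum A (fun P C => H P C * k) = csum A H * k.
Proof. by rewrite /csum mulr_suml. Qed.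

Lemma csum_mull A (H : forest D -> forest D -> K) k :
  csum A (fun P C => k * H P C) = k * csum A H.
Proof. by rewrite /csum mulr_sumr. Qed.

(** Associativity of convolution, that is coassociativity of the forest coproduct. It yields
    compatibility with deconcatenation. *)
Lemma word_coef_cat u w A :
  word_coef (u ++ w) A = csum A (fun P C => word_coef u P * word_coef w C).
Proof.
elim: u A => [|d u IH] A /=.
  rewrite -[LHS](csum_counitl A); apply: eq_csum => P C _.
  by case: (P == mone); rewrite ?mul1r ?mul0r.
under eq_csum => P C _ do rewrite IH -csum_mull.
rewrite -csum_coassoc; apply: eq_csum => P C _; rewrite -csum_mulr.
by apply: eq_csum => P1 P2 _; rewrite mulrA.
Qed.

Lemma fdegree_eq0 A : fdegree A = 0%N -> A = mone.
Proof.
rewrite /fdegree -{2}(forest_treesK A); case: (forest_trees A) => [|x s].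
  by rewrite !big_nil.
by have := valP x; rewrite big_cons; case: #|_|.
Qed.

Lemma fdegree1 : fdegree (mone : forest D) = 0%N.
Proof. by rewrite -forest_class_nil fdegree_class card_void. Qed.

(** Each letter uses up at least one edge, since [letter] vanishes at the unit. *)
Lemma word_coef_degree w A : (fdegree A < size w)%N -> word_coef w A = 0.
Proof.
elim: w A => //= d w IH A; rewrite ltnS => Aw.
transitivity (csum A (fun _ _ => 0 : K)); last exact: big1.
apply: eq_csum => P C PC; case P0: (fdegree P) => [|n].
  by rewrite (fdegree_eq0 P0) letter1 mcoeff0 mul0r.
by rewrite IH ?mulr0 //; apply: leq_trans Aw; rewrite -PC P0 addSn ltnS leq_addl.
Qed.

(** The truncation to words of length at most [n]. Building it by prefixing keeps the support finite
    even over an infinite alphabet. *)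
Fixpoint word_sum n A : Sh K D :=
  (A == mone)%:R *: << [::] >> +
  if n is n'.+1 then csum A (fun P C => Sh_cons (letter P) (word_sum n' C)) else 0.

Lemma mcoeff_csum (T : choiceType) A (H : forest D -> forest D -> {malg K[T]}) t :
  (csum A H)@_t = csum A (fun P C => (H P C)@_t).
Proof. by rewrite /csum raddf_sum. Qed.

Lemma mcoeff_word_sum n A w :
  (word_sum n A)@_w = if (size w <= n)%N then word_coef w A else 0.
Proof.
elim: n A w => [|n IH] A [|d w]; rewrite /= mcoeffD mcoeffZ mcoeffU /=.
- by rewrite mulr1 mcoeff0 addr0.
- by rewrite mulr0 mcoeff0 addr0.
- rewrite mulr1 mcoeff_csum [csum _ _]big1 ?addr0 // => e _.
  by rewrite mcoeff_Sh_cons.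
rewrite mulr0 add0r mcoeff_csum ltnS.
under eq_csum => P C _ do rewrite mcoeff_Sh_cons IH.
by case: ifP => // _; apply: big1 => e _; rewrite mulr0.
Qed.

Lemma word_coef_linear_exists :
  exists f : {linear CK K D -> Sh K D}, forall A w, (f << A >>)@_w = word_coef w A.
Proof.
exists (linext (fun A => word_sum (fdegree A) A)) => A w /=.
rewrite linextU mcoeff_word_sum.
by case: leqP => // Aw; rewrite word_coef_degree.
Qed.

Section BasisImages.
Variable psi : forest D -> Sh K D.
Hypothesis mcoeff_psi : forall A w, (psi A)@_w = word_coef w A.

Lemma ldiv_psi d A :
  Sh_ldiv d (psi A) = csum A (fun P C => (letter P)@_d *: psi C).
Proof.
apply/malgP => w; rewrite mcoeff_ldiv mcoeff_psi mcoeff_csum.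
by apply: eq_csum => P C _; rewrite mcoeffZ mcoeff_psi.
Qed.

(** Induction on [w]: dividing by its first letter is a derivation on the shuffle side, and
    [letterM] gives the same splitting on the forest side. *)
Lemma word_coefM A B w :
  word_coef w (mmul A B) = (Sh_mul (psi A) (psi B))@_w.
Proof.
elim: w A B => [|d w IH] A B.
  by rewrite Sh_mul_counit !mcoeff_psi /= cmM_eq1 -natrM mulnb.
rewrite -mcoeff_ldiv Sh_ldiv_mul mcoeffD !ldiv_psi /=.
have mulE : Sh_mul (csum A (fun P C => (letter P)@_d *: psi C)) (psi B) =
    csum A (fun P C => (letter P)@_d *: Sh_mul (psi C) (psi B)).
  rewrite /Sh_mul linear_sum; apply: eq_bigr => e _; exact: linearZ.
rewrite mulE linear_sum !raddf_sum /= csumM addrC.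
(* The first letter comes from [B] in the first sum and from [A] in the second; the other factor
   then has trivial left part, and [csum_counitl] removes its sum. *)
transitivity (csum B (fun P' C' => csum A (fun P C =>
      if P == mone then (letter P')@_d * word_coef w (mmul C C') else 0)) +
    csum A (fun P C => csum B (fun P' C' =>
      if P' == mone then (letter P)@_d * word_coef w (mmul C C') else 0))).
  rewrite [X in _ = X + _]csum_exchange -csumD; apply: eq_csum => P C _.
  rewrite -csumD; apply: eq_csum => P' C' _.
  rewrite letterM mcoeffD mulrDl.
  by congr (_ + _); case: (_ == _); rewrite ?mcoeff0 ?mul0r.
congr (_ + _); apply: eq_bigr => e _.
  rewrite (csum_counitl A (fun C => _ * word_coef w (mmul C _))) IH.
  by rewrite linearZ /= mcoeffZ.
rewrite (csum_counitl B (fun C => _ * word_coef w (mmul _ C))) IH.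
by rewrite mcoeffZ.
Qed.

End BasisImages.

Variable ck_to_sh : {linear CK K D -> Sh K D}.
Hypothesis mcoeff_ck_to_sh : forall A w, (ck_to_sh << A >>)@_w = word_coef w A.

Lemma CK_coprodU A :
  CK_coprod << A >> = csum A (fun P C => << (P, C) >>) :> {malg K[_]}.
Proof. by rewrite /CK_coprod linextU. Qed.

Lemma mcoeff_tensmap_coprod (f : CK K D -> Sh K D) A u w :
  (tensmap f f (CK_coprod << A >>))@_(u, w) =
  csum A (fun P C => (f << P >>)@_u * (f << C >>)@_w).
Proof.
rewrite CK_coprodU /tensmap /csum linear_sum raddf_sum; apply: eq_bigr => e _.
by rewrite /= linextU mcoeff_tens.
Qed.

Lemma ck_to_sh_hopf : hopf_morphism ck_to_sh.
Proof.
split=> [||x|x].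
- exact: linearP.
- split; first apply/malgP => w.
    rewrite mcoeff_ck_to_sh mcoeffU; case: w => [|d w].
      by rewrite /= eqxx.
    (* The unit has degree zero, below the length of any nonempty word. *)
    by apply: (@word_coef_degree (d :: w)); rewrite fdegree1.
  move=> x y; move: x.
  apply: eq_linear_malg => [k x1 x2|k x1 x2|A] /=.
  + by rewrite mulrDl -scalerAl linearP.
  + by rewrite linearP Sh_mul_linearl.
  move: y; apply: eq_linear_malg => [k y1 y2|k y1 y2|B] /=.
  + by rewrite mulrDr -scalerAr linearP.
  + by rewrite !linearP.
  apply/malgP => w; rewrite -(word_coefM mcoeff_ck_to_sh) -mcoeff_ck_to_sh.
  congr (mcoeff _ (ck_to_sh _)).
  by rewrite malgM_def fgmulUU mulr1.
- move: x; apply: eq_linear_malg => [k x1 x2|k x1 x2|A] /=.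
  + by rewrite /Sh_coprod !linearP.
  + by rewrite /CK_coprod /tensmap !linearP.
  apply/malgP => -[u w]; rewrite mcoeff_Sh_coprod mcoeff_tensmap_coprod.
  rewrite mcoeff_ck_to_sh word_coef_cat; apply: eq_csum => P C _.
  by rewrite !mcoeff_ck_to_sh.
rewrite /Sh_counit /CK_counit; move: x.
apply: (@eq_linear_malg _ _ K^o) => [k x y|k x y|A].
- by rewrite linearP mcoeffD mcoeffZ.
- by rewrite mcoeffD mcoeffZ.
by rewrite mcoeff_ck_to_sh mcoeffU.
Qed.

Lemma proj_ck_to_sh x : Sh_proj (ck_to_sh (CK_incl x)) = phi x.
Proof.
move: x; apply: eq_linear_malg => [k x1 x2|k x1 x2|x] /=.
- by rewrite /CK_incl /Sh_proj !linearP.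
- exact: linearP.
apply/malgP => d; rewrite mcoeff_Sh_proj /CK_incl linextU mcoeff_ck_to_sh.
by rewrite word_coef1 letter_tree.
Qed.

(** Induction on the number of trees: [mcoeff_Sh_mul_letter] and [letterM] give both sides the same
    recursion. *)
Lemma Sh_proj_multiplicative (psi : forest D -> Sh K D) A :
  psi mone = Sh_one K D ->
  (forall B C, psi (mmul B C) = Sh_mul (psi B) (psi C)) ->
  (forall B, (psi B)@_[::] = (B == mone)%:R) ->
  (forall x : etree D, Sh_proj (psi (forest_of_tree x)) = phi << x >>) ->
  Sh_proj (psi A) = letter A.
Proof.
move=> psi1 psiM psi0 psi_tree; apply/malgP => d.
rewrite -(forest_treesK A); elim: (forest_trees A) => [|x s IH].
  by rewrite big_nil letter1 psi1 mcoeff_Sh_proj mcoeff0 mcoeffU.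
rewrite big_cons; move: IH; set B := \big[_/_]_(_ <- _) _ => IH.
rewrite psiM letterM mcoeffD cm1_eq1 mcoeff0 add0r.
rewrite mcoeff_Sh_proj mcoeff_Sh_mul_letter -!mcoeff_Sh_proj !psi0 psi_tree.
rewrite letter_tree cm1_eq1 mul0r addr0.
by case: (B == mone); rewrite ?mulr1 ?mulr0 ?mcoeff0.
Qed.

Lemma hopf_morphism_letter (f : CK K D -> Sh K D) A :
  hopf_morphism f -> (forall x, Sh_proj (f (CK_incl x)) = phi x) ->
  Sh_proj (f << A >>) = letter A.
Proof.
move=> [lf [f1 fM] _ fcounit] fphi.
apply: (@Sh_proj_multiplicative (fun B => f << B >>)) => [//|B C|B|x].
- by rewrite -fM malgM_def fgmulUU mulr1.
- by have := fcounit << B >>; rewrite /Sh_counit /CK_counit mcoeffU.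
- by rewrite -fphi /CK_incl linextU.
Qed.

(** Induction on the word: the counit fixes the coefficient of the empty word, and
    comultiplicativity splits off the first letter, whose coefficient is given by [letter]. *)
Lemma hopf_morphism_unique (f : CK K D -> Sh K D) :
  hopf_morphism f -> (forall x, Sh_proj (f (CK_incl x)) = phi x) ->
  f = ck_to_sh :> (_ -> _).
Proof.
move=> fhopf fphi; apply/funext; have [lf _ fcop fcounit] := fhopf.
apply: eq_linear_malg => [//||A]; first exact: linearP.
apply/malgP => w; rewrite mcoeff_ck_to_sh; elim: w A => [|d w IH] A /=.
  have := fcounit << A >>; rewrite /Sh_counit /CK_counit => ->.
  by rewrite mcoeffU.
(* The coefficient of [d :: w] is read as that of the pair [([:: d], w)] in the coproduct. *)
rewrite -cat1s -mcoeff_Sh_coprod fcop mcoeff_tensmap_coprod; apply: eq_csum => P C _.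
by rewrite IH -mcoeff_Sh_proj hopf_morphism_letter.
Qed.

End UniversalMorphism.

Theorem mainTheorem16 (K : fieldType) (charK : [pchar K] =i pred0)
    (D : choiceType) (D_nonempty : inhabited D)
    (phi : {linear {malg K[etree D]} -> {malg K[D]}}) :
  exists! Phi : CK K D -> Sh K D,
    hopf_morphism Phi /\ (forall x, Sh_proj (Phi (CK_incl x)) = phi x).
Proof.
have [f fE] := word_coef_linear_exists phi.
exists f; split; first by split; [exact: ck_to_sh_hopf fE | exact: proj_ck_to_sh fE].
by move=> g [ghopf gphi]; rewrite (hopf_morphism_unique fE ghopf gphi).
Qed.
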